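(* Let $w=\phi(x,y)\in\mathbb{Z}^\infty*\mathbb{Z}^\infty$, with $(x,y)\in M_n\times M_n$, be a word of reduced length $2n$. Let $p,q$ be positive integers and assume that the following two implications hold: (1) if $(\lambda_j)_{j=1}^n$ is a nonzero vector of nonnegative integers with $\sum_{j}\lambda_j x_j^{(i)}=0$ for all $i$, then $\sum_j\lambda_j\geq p$; (2) if $(\mu_j)_{j=1}^n$ is a nonzero vector of nonnegative integers with $\sum_{j}\mu_j y_j^{(i)}=0$ for all $i$, then $\sum_j\mu_j\geq q$. Then $$\operatorname{scl}(w)\geq\frac n2\Big(1-\frac1p-\frac1q\Big).$$
   Context: For a group $G$ and $g\in[G,G]$, $\operatorname{cl}(g)$ is the least number of commutators in $G$ whose product is $g$, and the stable commutator length is $\operatorname{scl}(g)=\lim_{k\to\infty}\operatorname{cl}(g^k)/k$. $\mathbb{Z}^\infty$ is the free abelian group on countably many generators; the generators of the left factor of the free product $\mathbb{Z}^\infty*\mathbb{Z}^\infty$ are $a_1,a_2,\dots$, those of the right factor are $b_1,b_2,\dots$. Let $U=\{z\in\mathbb{Z}^n:\sum_j z_j=0\}$ and let $M_n$ be the set of all finitely supported sequences $z=(z^{(1)},z^{(2)},\dots)$ of vectors $z^{(i)}=(z^{(i)}_1,\dots,z^{(i)}_n)\in U$ such that for every $j\in\{1,\dots,n\}$ there is an $i$ with $z^{(i)}_j\neq0$. For $(x,y)\in M_n\times M_n$ put $$\phi(x,y)=\big(a_1^{x^{(1)}_1}a_2^{x^{(2)}_1}\cdots\big)\big(b_1^{y^{(1)}_1}b_2^{y^{(2)}_1}\cdots\big)\cdots\big(a_1^{x^{(1)}_n}a_2^{x^{(2)}_n}\cdots\big)\big(b_1^{y^{(1)}_n}b_2^{y^{(2)}_n}\cdots\big).$$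 The map $\phi$ is a bijection from $M_n\times M_n$ onto the words of reduced length $2n$, i.e. the elements of the commutator subgroup of the form $u_1v_1\cdots u_nv_n$ with the $u_i$ nontrivial in the left factor and the $v_i$ nontrivial in the right factor. *)

(* Defs.v *)
From HB Require Import structures.
From mathcomp Require Import all_boot all_order all_algebra finmap.
From mathcomp Require Import all_classical all_reals all_analysis.
From mathcomp.multinomials Require Import freeg.

Set Implicit Arguments.
Unset Strict Implicit.
Unset Printing Implicit Defensive.

Import GRing.Theory numFieldNormedType.Exports.

Local Open Scope group_scope.

Section FreeProduct.
Variables A B : groupType.
Implicit Types (l m : (A + B)%type) (s t u : seq (A + B)).

Definition letter_trivial l : bool :=
  match l with inl a => a == 1 | inr b => b == 1 end.

Definition same_factor l m : bool :=
  match l, m with inl _, inl _ | inr _, inr _ => true | _, _ => false end.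

Definition letter_inv l : A + B :=
  match l with inl a => inl a^-1 | inr b => inr b^-1 end.

(* Normal forms: words in nontrivial letters, taken alternately from A and B. *)
Definition fp_reduced s : bool :=
  all (fun l => ~~ letter_trivial l) s &&
  sorted (fun l m => ~~ same_factor l m) s.

(* Left multiplication of a normal form by one, possibly trivial, letter. *)
Definition fp_act l s : seq (A + B) :=
  match l, s with
  | inl a, inl a' :: s' => if a * a' == 1 then s' else inl (a * a') :: s'
  | inr b, inr b' :: s' => if b * b' == 1 then s' else inr (b * b') :: s'
  | _, _ => if letter_trivial l then s else l :: s
  end.

Record freeprod := FreeProd { fp_word :> seq (A + B); _ : fp_reduced fp_word }.

HB.instance Definition _ := [isSub for fp_word].
HB.instance Definition _ := [Choice of freeprod by <:].

Lemma fp_reduced_behead l s : fp_reduced (l :: s) -> fp_reduced s.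
Proof.
case/andP=> /= /andP[_ ss] ps; apply/andP; split=> //.
by case: s ps {ss} => //= m s /andP[].
Qed.

Lemma fp_act_reduced l s : fp_reduced s -> fp_reduced (fp_act l s).
Proof.
case: s => [|m s] rs.
  by case: l => x /=; case: ifP => // x1; rewrite /fp_reduced /= x1.
have rs' := fp_reduced_behead rs.
case: l m rs => [x|x] [y|y] rs /=; case: ifP => // xy1;
  move: rs; rewrite /fp_reduced /= ?xy1 => /andP[/andP[y1 ->] ps];
  rewrite ?y1 //=; by case: s ps {rs'} => [|[z|z] s].
Qed.

Lemma fp_mul_reduced s t : fp_reduced t -> fp_reduced (foldr fp_act t s).
Proof. by move=> rt; elim: s => //= l s; apply: fp_act_reduced. Qed.

Lemma fp_act_inl a a' s : fp_reduced s ->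
  fp_act (inl a) (fp_act (inl a') s) = fp_act (inl (a * a')) s.
Proof.
case: s => [|[y|y] s] rs /=.
- case: eqP => [->|_] /=; first by rewrite mulg1.
  by case: ifP.
- rewrite -mulgA; case: eqP => [->|_] //=; rewrite mulg1.
  have ns z s' : s = z :: s' -> ~~ same_factor (inl y) z.
    by move=> ss; move: rs; rewrite /fp_reduced ss /= => /and3P[_ ->].
  by case: s rs ns => [|[z|z] s] rs ns //=; have := ns _ _ erefl.
- case: eqP => [->|_] /=; first by rewrite mulg1.
  by case: ifP.
Qed.

Lemma fp_act_inr b b' s : fp_reduced s ->
  fp_act (inr b) (fp_act (inr b') s) = fp_act (inr (b * b')) s.
Proof.
case: s => [|[y|y] s] rs /=.
- case: eqP => [->|_] /=; first by rewrite mulg1.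
  by case: ifP.
- case: eqP => [->|_] /=; first by rewrite mulg1.
  by case: ifP.
- rewrite -mulgA; case: eqP => [->|_] //=; rewrite mulg1.
  have ns z s' : s = z :: s' -> ~~ same_factor (inr y) z.
    by move=> ss; move: rs; rewrite /fp_reduced ss /= => /and3P[_ ->].
  by case: s rs ns => [|[z|z] s] rs ns //=; have := ns _ _ erefl.
Qed.

Lemma fp_act1 l s : letter_trivial l -> fp_reduced s -> fp_act l s = s.
Proof.
case: l => x /= /eqP->; case: s => [|[y|y] s]; rewrite ?eqxx ?mul1g //= =>
  /andP[/= /andP[ny _] _]; by rewrite ifN.
Qed.

Lemma fp_act_mul l s t : fp_reduced s -> fp_reduced t ->
  foldr fp_act t (fp_act l s) = fp_act l (foldr fp_act t s).
Proof.
move=> rs rt; case: s rs => [|m s] rs.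
  case: l => x; rewrite [in LHS]/=; case: ifP => // x1;
  by rewrite [RHS]fp_act1.
have rv := fp_mul_reduced s rt.
rewrite -[RHS]/(fp_act l (fp_act m (foldr fp_act t s))).
case: l m rs => [x|x] [y|y] rs; rewrite ?(fp_act_inl, fp_act_inr) // [in LHS]/=;
  case: ifP => // x1; by rewrite [RHS]fp_act1 // fp_act_reduced.
Qed.

Lemma fp_inv_reduced s : fp_reduced s -> fp_reduced (rev (map letter_inv s)).
Proof.
case/andP=> ts ps; rewrite /fp_reduced all_rev all_map rev_sorted sorted_map.
apply/andP; split.
  by apply: sub_all ts => -[x|x] /=; rewrite invg_eq1.
by apply: sub_sorted ps => -[x|x] [y|y].
Qed.

Definition fp_one : freeprod := @FreeProd [::] isT.
Definition fp_mul (s t : freeprod) : freeprod :=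
  FreeProd (fp_mul_reduced s (valP t)).
Definition fp_inv (s : freeprod) : freeprod := FreeProd (fp_inv_reduced (valP s)).

Lemma fp_mulA : associative fp_mul.
Proof.
move=> s t u; apply: val_inj => /=; case: s => s /= _.
elim: s => //= l s ->; rewrite fp_act_mul ?(valP u) //.
exact: fp_mul_reduced (valP t).
Qed.

Lemma fp_mul1 : left_id fp_one fp_mul.
Proof. by move=> s; apply: val_inj. Qed.

Lemma fp_mulr1 : right_id fp_one fp_mul.
Proof.
case=> s rs; apply: val_inj => /=; elim: s rs => //= l s IHs rs.
rewrite IHs ?(fp_reduced_behead rs) //.
case/andP: rs => /= /andP[/negPf tl _].
by case: l s tl {IHs} => x [|[y|y] s] //= ->.
Qed.

Lemma fp_mulV : left_inverse fp_one fp_inv fp_mul.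
Proof.
case=> s rs; apply: val_inj => /= {rs}; elim: s => //= l s IHs.
by rewrite rev_cons foldr_rcons; case: l => x /=; rewrite mulVg eqxx.
Qed.

Lemma fp_invK : involutive fp_inv.
Proof.
move=> s; apply: val_inj; rewrite /= map_rev revK -map_comp map_id_in //.
by case=> x _ /=; rewrite invgK.
Qed.

Lemma fp_mulrV : right_inverse fp_one fp_inv fp_mul.
Proof. by move=> s; rewrite -{1}(fp_invK s) fp_mulV. Qed.

HB.instance Definition _ :=
  isGroup.Build freeprod fp_mulA fp_mul1 fp_mulr1 fp_mulV fp_mulrV.

Definition fp_inl (a : A) : freeprod :=
  FreeProd (fp_act_reduced (inl a) (isT : fp_reduced [::])).
Definition fp_inr (b : B) : freeprod :=
  FreeProd (fp_act_reduced (inr b) (isT : fp_reduced [::])).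

Lemma fp_inlM : {morph fp_inl : a a' / a * a'}.
Proof.
move=> a a'; apply: val_inj; rewrite -[LHS]/(fp_act (inl (a * a')) [::]).
rewrite -fp_act_inl // -[RHS]/(foldr fp_act (fp_inl a') (fp_act (inl a) [::])).
by rewrite fp_act_mul // (valP (fp_inl a')).
Qed.

Lemma fp_inrM : {morph fp_inr : b b' / b * b'}.
Proof.
move=> b b'; apply: val_inj; rewrite -[LHS]/(fp_act (inr (b * b')) [::]).
rewrite -fp_act_inr // -[RHS]/(foldr fp_act (fp_inr b') (fp_act (inr b) [::])).
by rewrite fp_act_mul // (valP (fp_inr b')).
Qed.

HB.instance Definition _ := isMultiplicative.Build A freeprod fp_inl fp_inlM.
HB.instance Definition _ := isMultiplicative.Build B freeprod fp_inr fp_inrM.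

End FreeProduct.

Section CommutatorLength.
Variable G : groupType.

Definition commutator_product (k : nat) (g : G) : Prop :=
  exists s : k.-tuple (G * G), g = \prod_(c <- s) [~ c.1, c.2].

(* Meaningful only on the commutator subgroup; the value is 0 elsewhere. *)
Definition cl (g : G) : nat :=
  xget 0%N [set k | commutator_product k g /\
                    forall m, commutator_product m g -> (k <= m)%N].

Definition scl (R : realType) (g : G) : R :=
  limn (fun k : nat => ((cl (g ^+ k))%:R / k%:R)%R : R).

End CommutatorLength.

Definition zexpg (G : groupType) (g : G) (k : int) : G :=
  match k with Posz m => g ^+ m | Negz m => g ^- m.+1 end.

Definition Zinf : groupType := Algebra.to_multiplicative {freeg nat}.

(* The generators are numbered from 0. *)
Definition gen_a (i : nat) : freeprod Zinf Zinf := fp_inl Zinf (<< i >>%R : Zinf).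
Definition gen_b (i : nat) : freeprod Zinf Zinf := fp_inr Zinf (<< i >>%R : Zinf).

Local Open Scope ring_scope.

(* [z i 0 j] is the j-th coordinate of the i-th vector of the sequence [z]. *)
Notation fsseq n := {fsfun nat -> 'rV[int]_n with 0}.

Definition U (n : nat) : set 'rV[int]_n := [set v | \sum_j v 0 j = 0].

Definition M (n : nat) : set (fsseq n) :=
  [set z | (forall i, U (z i)) /\ (forall j, exists i, z i 0 j != 0)].
Arguments M : clear implicits.

(* The enumeration order of [finsupp] is irrelevant, as the a_i commute with
   each other and so do the b_i. *)
Definition phi (n : nat) (x y : fsseq n) : freeprod Zinf Zinf :=
  (\prod_(j < n) ((\prod_(i <- finsupp x) zexpg (gen_a i) (x i 0%R j)) *
                  (\prod_(i <- finsupp y) zexpg (gen_b i) (y i 0%R j))))%g.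

(* Main.v *)
From HB Require Import structures.
Require Import Defs.
From mathcomp Require Import all_boot all_order all_algebra finmap.
From mathcomp Require Import all_classical all_reals all_analysis.
From mathcomp.multinomials Require Import freeg.
From mathcomp Require Import zify ring lra.

Set Implicit Arguments.
Unset Strict Implicit.
Unset Printing Implicit Defensive.

Import Order.TTheory GRing.Theory Num.Theory numFieldNormedType.Exports.

(** The lower bound comes from an explicit quasimorphism, through the easy half
    of Bavard duality.

    Let [F] be an odd function on a group [G] such that [F (g h) - F g - F h]
    always lies in [[-D, D]].  A commutator is a product of four factors on which
    the values of [F] cancel in pairs, so a product of [k] commutators has
    [|F| <= 4 D k].  If moreover [F (w^k) = k F w] for all [k], then
    [scl w >= |F w| / (4 D)] ([scl_ge_quasimorphism]).  As [scl] is defined as a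
    limit, the convergence of [cl (w^k) / k] has to be known first: this is
    Fekete's lemma.

    On a free product [A * B], adding up odd functions [f] of the letters in [A]
    and [g] of the letters in [B] over normal forms gives such an [F] (a
    construction of Rolli).  In a product of two normal forms, inverse letters
    cancel at the junction, and so do their values; then at most one pair of
    letters merges, so the defect of [F] is at most that of [f] and [g]
    ([rolli_defect]).

    It remains to choose [f].  Let [u_1, .., u_n] be the letters of [w] in [A],
    and suppose that a nonempty product of [u_j]'s is trivial only if it has at
    least [p] factors.  Call length of [a] the least [r] such that [a] is a
    product of [r] of the [u_j], let [h a] be [p - 2 r] if [r] exists and this is
    positive, and [0] otherwise, and put [f a = (h (a^-1) - h a) / (2 p)].  The
    assumption on the [u_j] gives [f] defect at most [1/2] ([gauge_defect]), while
    [f (u_j) <= 1/p - 1/2] ([gauge_generator_le]).  With the analogous [g] for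
    [q], [F w <= - n (1 - 1/p - 1/q)] and [D = 1/2], which is the bound.

    For the free abelian factors of the theorem, a trivial product of letters
    [u_j] is recorded by the numbers of times that each [j] occurs in it, and
    these numbers form a vector [lambda] or [mu] as in the hypotheses
    ([column_relation]). *)

Local Open Scope ring_scope.

(** * Subadditive sequences *)

Section Fekete.
Variables (R : realType) (u : nat -> R).
Hypothesis u_ge0 : forall n, 0 <= u n.
Hypothesis u_sub : forall m n, u (m + n)%N <= u m + u n.

Lemma subadditive_mul_le k m r : u (k * m + r)%N <= k%:R * u m + u r.
Proof.
elim: k => [|k IHk]; first by rewrite mul0r add0r.
rewrite mulSn -addnA (le_trans (u_sub _ _)) // -natr1 mulrDl mul1r.
by lra.
Qed.

(** The limit is the infimum of the quotients [u m / m], [m > 0]: if [m] nearly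
    realizes it, then Euclidean division by [m] bounds [u n] by [(n / m) u m]
    up to a constant. *)
Lemma fekete : cvgn (fun n => u n / n%:R).
Proof.
set S := [set u n.+1 / n.+1%:R | n in [set: nat]]%classic.
have S_inf : has_inf S.
  split; first by exists (u 1%N / 1%:R); exists 0%N.
  by exists 0 => _ [n _ <-]; rewrite divr_ge0.
apply/cvg_ex; exists (inf S); apply/cvgrPdist_le => e e_gt0.
have e2_gt0 : 0 < e / 2 by rewrite divr_gt0.
have [_ [m _ <-] um_lt] := inf_adherent e2_gt0 S_inf.
set C := \sum_(r < m.+1) u r.
have C_ge r : (r < m.+1)%N -> u r <= C.
  move=> r_lt; rewrite /C (bigD1 (Ordinal r_lt)) //= lerDl.
  by apply: sumr_ge0.
have C_ge0 : 0 <= C by apply: sumr_ge0.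
set N := Num.bound (C / (e / 2)).
have N_gt : C / (e / 2) < N%:R by apply: archi_boundP; rewrite divr_ge0 // ltW.
exists N.+1 => // n /= Nn.
have n_gt0 : (0 < n)%N by lia.
have nR_gt0 : 0 < n%:R :> R by rewrite ltr0n.
have inf_le : inf S <= u n / n%:R.
  apply: ge_inf; first exact: S_inf.2.
  by exists n.-1 => //; rewrite prednK.
rewrite distrC ger0_norm ?subr_ge0 // lerBlDr ler_pdivrMr //.
have mR_gt0 : 0 < m.+1%:R :> R by rewrite ltr0n.
have u_le : u n <= (n %/ m.+1)%:R * u m.+1 + C.
  rewrite {1}(divn_eq n m.+1) (le_trans (subadditive_mul_le _ _ _)) //.
  by rewrite lerD2l C_ge // ltn_pmod.
have quo_le : (n %/ m.+1)%:R * u m.+1 <= n%:R * (u m.+1 / m.+1%:R).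
  rewrite mulrA ler_pdivlMr // mulrAC ler_wpM2r // -natrM ler_nat.
  exact: leq_divM.
have um_le : n%:R * (u m.+1 / m.+1%:R) <= n%:R * (inf S + e / 2).
  by rewrite ler_wpM2l // ltW.
have C_le : C <= n%:R * (e / 2).
  move: N_gt; rewrite ltr_pdivrMr // => /ltW/le_trans; apply.
  by rewrite ler_wpM2r ?(ltW e2_gt0) // ler_nat; lia.
apply: (le_trans u_le); apply: (le_trans (lerD (le_trans quo_le um_le) C_le)).
by rewrite -mulrDr -addrA -splitr mulrC addrC.
Qed.

End Fekete.

(** * Products of commutators *)

Section CommutatorProducts.
Variable G : groupType.
Implicit Types (g h : G) (k m : nat).

Local Open Scope group_scope.

Definition in_derived g := exists k, commutator_product k g.

Lemma commutator_product1 : commutator_product 0 (1 : G).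
Proof. by exists [tuple]; rewrite big_nil. Qed.

Lemma commutator_productM k m g h :
  commutator_product k g -> commutator_product m h ->
  commutator_product (k + m) (g * h).
Proof.
move=> [s ->] [t ->]; exists (cat_tuple s t).
by rewrite big_cat.
Qed.

Lemma commutator_productJ k g h :
  commutator_product k g -> commutator_product k (g ^ h).
Proof.
move=> [s ->]; exists (map_tuple (fun c => (c.1 ^ h, c.2 ^ h)) s).
rewrite big_map conjg_prod; apply: eq_bigr => c _; exact: conjRg.
Qed.

Lemma in_derived1 : in_derived 1.
Proof. by exists 0%N; apply: commutator_product1. Qed.

Lemma in_derivedM g h : in_derived g -> in_derived h -> in_derived (g * h).
Proof. by move=> [k gk] [m hm]; exists (k + m)%N; apply: commutator_productM. Qed.

Lemma in_derivedJ g h : in_derived g -> in_derived (g ^ h).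
Proof. by move=> [k gk]; exists k; apply: commutator_productJ. Qed.

Lemma in_derivedR g h : in_derived [~ g, h].
Proof. by exists 1%N; exists [tuple (g, h)]; rewrite big_seq1. Qed.

Lemma in_derivedX g k : in_derived g -> in_derived (g ^+ k).
Proof.
move=> dg; elim: k => [|k IHk]; first exact: in_derived1.
by rewrite expgS; apply: in_derivedM.
Qed.

(** In the abelianization, the factors [a i] and [b i] can be sorted apart. *)
Lemma in_derived_prod (I : Type) (s : seq I) (a b : I -> G) :
  \prod_(i <- s) a i = 1 -> \prod_(i <- s) b i = 1 ->
  in_derived (\prod_(i <- s) (a i * b i)).
Proof.
move=> a1 b1.
suff [c dc ->] : exists2 c, in_derived c &
    \prod_(i <- s) (a i * b i) = \prod_(i <- s) a i * \prod_(i <- s) b i * c.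
  by rewrite a1 b1 !mul1g.
elim: s {a1 b1} => [|i s [c dc IHs]].
  by exists 1; rewrite ?big_nil ?mulg1 //; apply: in_derived1.
rewrite !big_cons IHs; set x := \prod_(j <- s) a j; set y := \prod_(j <- s) b j.
(* Moving [b i] to the right of [x] creates the commutator [[~ b i, x]], which
   then has to be moved past [y]. *)
exists ([~ b i, x] ^ y * c).
  by apply: in_derivedM => //; apply/in_derivedJ/in_derivedR.
by rewrite /commg /conjg !mulgA !mulgK.
Qed.

(** The default value in the definition of [cl] is reached only outside the
    commutator subgroup. *)
Lemma cl_minimal g : in_derived g ->
  commutator_product (cl g) g /\ forall m, commutator_product m g -> (cl g <= m)%N.
Proof.
move=> [k gk].
pose P m := `[< commutator_product m g >].
have exP : exists m, P m by exists k; apply/asboolP.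
have [m /asboolP gm min_m] := ex_minnP exP.
rewrite /cl; case: xgetP => [k' -> //|/(_ m)[]]; split => // m' /asboolP.
exact: min_m.
Qed.

Lemma cl_subadditive g h : in_derived g -> in_derived h ->
  (cl (g * h) <= cl g + cl h)%N.
Proof.
move=> dg dh; apply: (cl_minimal (in_derivedM dg dh)).2.
by apply: commutator_productM; [apply: (cl_minimal dg).1|apply: (cl_minimal dh).1].
Qed.

End CommutatorProducts.

(** * The lower bound for scl given by an odd quasimorphism *)

Section Quasimorphism.
Variables (R : realType) (G : groupType) (f : G -> R) (D : R).
Hypothesis f_odd : forall g, f g^-1%g = - f g.
Hypothesis f_defect : forall g h, `|f (g * h)%g - f g - f h| <= D.

(** Multiplication by [x^-1 y^-1 x y] takes four multiplications, each of which
    costs at most [D]; the values at the four factors cancel. *)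
Lemma commutator_product_quasimorphism_le k g :
  commutator_product k g -> `|f g| <= 4 * D * k%:R.
Proof.
move=> [s ->]; elim: k s => [|k IHk] s.
  have f1 : f 1%g = 0 by have := f_odd 1%g; rewrite invg1; lra.
  by rewrite tuple0 big_nil mulr0 f1 normr0.
case/tupleP: s => -[x y] s; rewrite big_cons /=; have := IHk s.
set g' := (\prod_(c <- s) _)%g; rewrite /commg /conjg -!mulgA -natr1.
have := f_defect x^-1%g (y^-1 * (x * (y * g')))%g.
have := f_defect y^-1%g (x * (y * g'))%g.
have := f_defect x (y * g')%g.
have := f_defect y g'.
rewrite !f_odd !ler_norml => /andP[? ?] /andP[? ?] /andP[? ?] /andP[? ?] /andP[? ?].
by apply/andP; split; lra.
Qed.

Lemma scl_ge_quasimorphism g : 0 < D -> in_derived g ->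
  (forall k, f (g ^+ k)%g = f g *+ k) -> `|f g| / (4 * D) <= scl R g.
Proof.
move=> D_gt0 dg f_X.
have D4_gt0 : 0 < 4 * D by rewrite mulr_gt0.
have cvg_cl : cvgn (fun k : nat => (cl (g ^+ k)%g)%:R / k%:R : R).
  apply: fekete => // m n; rewrite -natrD ler_nat expgnDr.
  by apply: cl_subadditive; apply: in_derivedX.
apply: limr_ge => //; exists 1%N => // k /= k_gt0.
rewrite ler_pdivlMr ?ltr0n // mulrAC ler_pdivrMr // mulrC.
rewrite [leLHS]mulr_natl -normrMn -f_X [leRHS]mulrC.
apply: commutator_product_quasimorphism_le.
exact: (cl_minimal (in_derivedX k dg)).1.
Qed.

End Quasimorphism.

(** * Normal forms in a free product *)

Section NormalForms.
Variables A B : groupType.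
Implicit Types (l m : (A + B)%type) (s t : seq (A + B)) (x : freeprod A B).

Lemma fp_act_cons l s : fp_reduced (l :: s) -> fp_act l s = l :: s.
Proof.
case/andP=> /= /andP[/negPf ntl _].
by case: l ntl => a /= ntl; case: s => [|[b|b] s] //=; rewrite ntl.
Qed.

Lemma foldr_fp_act_cat s t :
  fp_reduced (s ++ t) -> foldr (@fp_act A B) t s = s ++ t.
Proof.
elim: s => //= l s IHs rst; rewrite IHs ?fp_act_cons //.
exact: fp_reduced_behead rst.
Qed.

Lemma fp_reduced_rcons_cons s l m t :
  fp_reduced (rcons s l ++ m :: t) =
  [&& fp_reduced (rcons s l), fp_reduced (m :: t) & ~~ same_factor l m].
Proof.
rewrite /fp_reduced all_cat.
have -> : sorted (fun l m => ~~ same_factor l m) (rcons s l ++ m :: t) =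
    [&& sorted (fun l m => ~~ same_factor l m) (rcons s l),
        ~~ same_factor l m & path (fun l m => ~~ same_factor l m) m t].
  by case: s => [|k s] //=; rewrite cat_path last_rcons.
rewrite [sorted _ (m :: t)]/=; lia.
Qed.

Lemma fp_reduced_rcons s l : fp_reduced (rcons s l) -> fp_reduced s.
Proof.
rewrite /fp_reduced all_rcons -cats1 => /andP[/andP[_ ->] /=].
by move/cat_sorted2=> [].
Qed.

Lemma same_factor_sym l m : same_factor l m = same_factor m l.
Proof. by case: l m => [a|b] []. Qed.

Lemma same_factor_trans k l m :
  same_factor k l -> same_factor k m = same_factor l m.
Proof. by case: k l m => [?|?] [?|?] [?|?]. Qed.

(** A right letter can be put in front of such a word without cancellation. *)
Definition starts_left x : bool :=
  match fp_word x with inr _ :: _ => false | _ => true end.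

End NormalForms.

Lemma fp_inl1 (A B : groupType) : fp_inl B (1 : A)%g = 1%g.
Proof. by apply: val_inj; rewrite /= eqxx. Qed.

Lemma fp_inr1 (A B : groupType) : fp_inr A (1 : B)%g = 1%g.
Proof. by apply: val_inj; rewrite /= eqxx. Qed.

HB.instance Definition _ (A B : groupType) :=
  Multiplicative_isUMagmaMorphism.Build A (freeprod A B) (@fp_inl A B) (fp_inl1 A B).
HB.instance Definition _ (A B : groupType) :=
  Multiplicative_isUMagmaMorphism.Build B (freeprod A B) (@fp_inr A B) (fp_inr1 A B).

(** * Sums over the letters of a normal form *)

Section Rolli.
Variables (R : realType) (A B : groupType) (f : A -> R) (g : B -> R) (D : R).
Implicit Types (l m : (A + B)%type) (s t : seq (A + B)) (x y : freeprod A B).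

Definition letter_value l : R := match l with inl a => f a | inr b => g b end.
Definition rolli s : R := \sum_(l <- s) letter_value l.

Lemma rolli_cons l s : rolli (l :: s) = letter_value l + rolli s.
Proof. exact: big_cons. Qed.

Lemma rolli_cat s t : rolli (s ++ t) = rolli s + rolli t.
Proof. exact: big_cat. Qed.

Hypothesis D_ge0 : 0 <= D.
Hypothesis f_odd : forall a, f a^-1%g = - f a.
Hypothesis g_odd : forall b, g b^-1%g = - g b.
Hypothesis f_defect : forall a a', `|f (a * a')%g - f a - f a'| <= D.
Hypothesis g_defect : forall b b', `|g (b * b')%g - g b - g b'| <= D.

Lemma letter_value_inv l : letter_value (letter_inv l) = - letter_value l.
Proof. by case: l => a /=; rewrite ?f_odd ?g_odd. Qed.

(** A letter [l] put in front of a normal form either stays there, or cancels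
    the first letter, or merges with it into a single letter [k] of the same
    factor.  Only the last case costs up to [D]. *)
Lemma fp_act_cases l t : ~~ letter_trivial l -> fp_reduced t ->
  (t = [::] \/ exists m t', t = m :: t' /\ ~~ same_factor l m) \/
  exists m t', [/\ t = m :: t', same_factor l m &
    (fp_act l t = t' /\ letter_value m = - letter_value l) \/
    exists2 k, fp_act l t = k :: t' /\ same_factor l k &
      `|letter_value k - letter_value l - letter_value m| <= D].
Proof.
move=> ntl; case: t => [|m t] rt; first by left; left.
case: (boolP (same_factor l m)) => lm; last by left; right; exists m, t.
right; exists m, t; split=> //.
case: l m ntl lm rt => [a|b] [a'|b'] //= ntl _ rt; case: ifP => [/eqP ab1|_].
- by left; rewrite -(mulg1_eq ab1) f_odd.
- by right; exists (inl (a * a')%g); [split|apply: f_defect].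
- by left; rewrite -(mulg1_eq ab1) g_odd.
- by right; exists (inr (b * b')%g); [split|apply: g_defect].
Qed.

(** The last letter of [s] meets the first letter of [t].  If they cancel, their
    values do too, and shorter words are left; if they merge, the result is a
    normal form and no further cancellation takes place. *)
Lemma rolli_foldr_fp_act s t : fp_reduced s -> fp_reduced t ->
  `|rolli (foldr (@fp_act A B) t s) - rolli s - rolli t| <= D.
Proof.
elim/last_ind: s t => [|s l IHs] t rs rt.
  by rewrite /= {2}/rolli big_nil subr0 subrr normr0.
have ntl : ~~ letter_trivial l by case/andP: rs; rewrite all_rcons => /andP[].
have concat : fp_reduced (rcons s l ++ t) ->
    `|rolli (foldr (@fp_act A B) t (rcons s l)) - rolli (rcons s l) - rolli t| <= D.
  by move/foldr_fp_act_cat->; rewrite rolli_cat addrAC addrK subrr normr0.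
case: (fp_act_cases ntl rt) => [[t0|[m [t' [tE lm]]]]|].
- by apply: concat; rewrite t0 cats0.
- by apply: concat; rewrite tE fp_reduced_rcons_cons rs -tE rt.
move=> [m [t' [tE lm [[actE mE]|[k [actE lk] k_le]]]]].
  have rt' : fp_reduced t' by rewrite tE in rt; apply: fp_reduced_behead rt.
  have := IHs t' (fp_reduced_rcons rs) rt'; congr (`|_| <= D).
  rewrite foldr_rcons actE tE -cats1 rolli_cat !rolli_cons mE [rolli [::]]big_nil.
  by ring.
have rkt : fp_reduced (k :: t') by rewrite -actE fp_act_reduced.
(* The merged letter lies in the factor of [l], which the letter before [l] avoids. *)
have rskt : fp_reduced (s ++ k :: t').
  case/lastP: s rs {IHs concat} => // s j rs.
  rewrite fp_reduced_rcons_cons rkt (fp_reduced_rcons rs) /=.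
  move: rs; rewrite -cats1 fp_reduced_rcons_cons => /and3P[_ _].
  by rewrite same_factor_sym (same_factor_trans _ lk) same_factor_sym.
move: k_le; congr (`|_| <= D).
rewrite foldr_rcons actE (foldr_fp_act_cat rskt) tE -cats1 !rolli_cat !rolli_cons.
by rewrite [rolli [::]]big_nil; ring.
Qed.

Lemma rolli_defect x y : `|rolli (x * y)%g - rolli x - rolli y| <= D.
Proof. exact: rolli_foldr_fp_act (valP x) (valP y). Qed.

Lemma rolli_odd x : rolli x^-1%g = - rolli x.
Proof.
rewrite /rolli /= (perm_big _ (permEl (perm_rev _))) big_map /= -sumrN.
by apply: eq_bigr => l _; apply: letter_value_inv.
Qed.

Lemma rolli_syllables a b x : a != 1%g -> b != 1%g -> starts_left x ->
  starts_left (fp_inl B a * fp_inr A b * x)%g /\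
  rolli (fp_inl B a * fp_inr A b * x)%g = f a + g b + rolli x.
Proof.
move=> /negPf a1 /negPf b1 x_left.
have wordE : fp_word (fp_inl B a * fp_inr A b * x)%g = [:: inl a, inr b & fp_word x].
  rewrite -mulgA /= a1 b1 /=; move: x_left; rewrite /starts_left.
  by case: (fp_word x) => [|[]] //=; rewrite b1 /= a1.
by split; rewrite ?/starts_left wordE // !rolli_cons /= addrA.
Qed.

Lemma rolli_prod (I : Type) (s : seq I) (a : I -> A) (b : I -> B) x :
  (forall i, a i != 1%g) -> (forall i, b i != 1%g) -> starts_left x ->
  starts_left (\prod_(i <- s) (fp_inl B (a i) * fp_inr A (b i)) * x)%g /\
  rolli (\prod_(i <- s) (fp_inl B (a i) * fp_inr A (b i)) * x)%g =
    \sum_(i <- s) (f (a i) + g (b i)) + rolli x.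
Proof.
move=> a1 b1 x_left; elim: s => [|i s [IHl IHs]].
  by rewrite !big_nil mul1g add0r.
rewrite !big_cons -[(_ * _ * x)%g]mulgA -addrA -IHs; exact: rolli_syllables.
Qed.

Lemma rolli_prod1 (I : Type) (s : seq I) (a : I -> A) (b : I -> B) :
  (forall i, a i != 1%g) -> (forall i, b i != 1%g) ->
  rolli (\prod_(i <- s) (fp_inl B (a i) * fp_inr A (b i)))%g =
  \sum_(i <- s) (f (a i) + g (b i)).
Proof.
move=> a1 b1; have := (rolli_prod s a1 b1 (isT : starts_left 1%g)).2.
by rewrite mulg1 => ->; rewrite [rolli _]big_nil addr0.
Qed.

(** Powers of [w] are concatenations of copies of [w], since [w] begins on the
    left factor and ends on the right one. *)
Lemma rolli_prodX (I : Type) (s : seq I) (a : I -> A) (b : I -> B) k :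
  (forall i, a i != 1%g) -> (forall i, b i != 1%g) ->
  let w := (\prod_(i <- s) (fp_inl B (a i) * fp_inr A (b i)))%g in
  rolli (w ^+ k)%g = rolli w *+ k.
Proof.
move=> a1 b1 w.
suff [] : starts_left (w ^+ k)%g /\ rolli (w ^+ k)%g = rolli w *+ k by [].
elim: k => [|k [IHl IHk]]; first by rewrite [rolli _]big_nil.
rewrite expgS mulrS -IHk rolli_prod1 //; exact: rolli_prod.
Qed.

End Rolli.

(** * A function on a group with many-term relations *)

Section Gauge.
Variables (G : groupType) (I : Type) (u : I -> G) (p : nat).
Implicit Types (a b c : G) (r : nat).

Definition spelled a r : Prop :=
  exists s : seq I, size s = r /\ (\prod_(i <- s) u i)%g = a.

Lemma spelled1 : spelled 1%g 0.
Proof. by exists [::]; rewrite big_nil. Qed.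

Lemma spelledM a b r r' :
  spelled a r -> spelled b r' -> spelled (a * b)%g (r + r')%N.
Proof.
by move=> [s [<- <-]] [t [<- <-]]; exists (s ++ t); rewrite size_cat big_cat.
Qed.

(** The positive part of [p - 2 r], where [r] is the least number of generators
    whose product is [a]; the value is [0] if there is no such [r]. *)
Definition closeness a : nat := \max_(r < p.+1 | `[< spelled a r >]) (p - 2 * r).

Lemma closeness_le a : (closeness a <= p)%N.
Proof. by apply/bigmax_leqP => r _; lia. Qed.

Lemma closeness_ge a r : spelled a r -> (p <= closeness a + 2 * r)%N.
Proof.
move=> ar; have [r_lt|] := ltnP r p.+1; last by lia.
by rewrite addnC -leq_subLR (bigop.bigmax_sup (Ordinal r_lt)) //; apply/asboolP.
Qed.

Lemma closeness_gt0 a : (0 < closeness a)%N ->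
  exists2 r, spelled a r & (closeness a + 2 * r)%N = p.
Proof.
rewrite /closeness; elim/big_ind: _ => // [m n IHm IHn|r /asboolP ar pr].
  by case: (leqP m n) => _; [apply: IHn|apply: IHm].
by exists r => //; lia.
Qed.

Lemma closenessM a b : (closeness a + closeness b <= closeness (a * b)%g + p)%N.
Proof.
have := closeness_le a; have := closeness_le b.
case: (posnP (closeness a)) => [->|/closeness_gt0[r ar]]; first by lia.
case: (posnP (closeness b)) => [->|/closeness_gt0[r' br']]; first by lia.
have := closeness_ge (spelledM ar br'); lia.
Qed.

Hypothesis relation_ge : forall s : seq I, s <> [::] ->
  (\prod_(i <- s) u i = 1)%g -> (p <= size s)%N.

Lemma spelled_relation r : spelled 1%g r -> r = 0%N \/ (p <= r)%N.
Proof.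
move=> [s [<- s1]]; case: s s1 => [|i s] s1; first by left.
by right; apply: relation_ge.
Qed.

(** In other words, the odd function [a |-> closeness a - closeness a^-1] has
    defect at most [p].  Say that [a] is close if [closeness a] is positive.  If at
    most one of [a], [b], [c] is close, the bound [closeness <= p] is enough.  If
    two are, say [a] and [b], subadditivity of lengths bounds [closeness (a b)]
    from below, and [a b = c^-1].  If all three are, of lengths [r], [r'], [r''], these spell
    a relation: the left-hand side is [3 p - 2 (r + r' + r'')], which is at most
    [p] when [r + r' + r'' >= p]. *)
Lemma closeness_triple a b c : (a * b * c = 1)%g ->
  (closeness a + closeness b + closeness c <=
   p + closeness a^-1%g + closeness b^-1%g + closeness c^-1%g)%N.
Proof.
move=> abc.
have cV : (c^-1 = a * b)%g by rewrite -(mulg1_eq abc) invgK.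
have aV : (a^-1 = b * c)%g by apply: mulg1_eq; rewrite mulgA.
have bV : (b^-1 = c * a)%g by rewrite -[c]invgK cV invgM mulgVK.
have := closenessM a b; have := closenessM b c; have := closenessM c a.
rewrite -aV -bV -cV.
have := closeness_le a; have := closeness_le b; have := closeness_le c.
case: (posnP (closeness a)) => [->|/closeness_gt0[r ar Er]]; first by lia.
case: (posnP (closeness b)) => [->|/closeness_gt0[r' br' Er']]; first by lia.
case: (posnP (closeness c)) => [->|/closeness_gt0[r'' cr'' Er'']]; first by lia.
have := spelledM (spelledM ar br') cr''; rewrite abc => /spelled_relation[r0|]; last by lia.
(* The empty relation: [a], [b] and [c] are trivial, and both sides are explicit. *)
have [r1 [r2 r3]] : r = 0%N /\ r' = 0%N /\ r'' = 0%N by lia.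
have spelled0 d : spelled d 0 -> (d = 1)%g.
  by move=> [[|i s] [//= _ <-]]; rewrite big_nil.
move: ar br' cr''; rewrite r1 r2 r3 => /spelled0-> /spelled0-> /spelled0->.
have := closeness_ge spelled1; have := closeness_le 1%g.
by rewrite invg1; lia.
Qed.

Section Value.
Variable R : realType.

Definition gauge a : R := ((closeness a^-1%g)%:R - (closeness a)%:R) / (2 * p%:R).

Lemma gauge_odd a : gauge a^-1%g = - gauge a.
Proof. by rewrite /gauge invgK -mulNr opprB. Qed.

Hypothesis p_gt0 : (0 < p)%N.

Lemma gauge_defect a b : `|gauge (a * b)%g - gauge a - gauge b| <= 2^-1.
Proof.
have p2_gt0 : 0 < 2 * p%:R :> R by rewrite mulr_gt0 ?ltr0n.
rewrite -mulrBl -mulrBl normrM (gtr0_norm (_ : 0 < (2 * p%:R)^-1)) ?invr_gt0 //.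
rewrite ler_pdivrMr // mulKf // ler_norml.
have := closeness_triple (mulgV (a * b)%g).
have : (b^-1 * a^-1 * (a * b) = 1)%g by rewrite -invgM mulVg.
move/closeness_triple; rewrite !invgK -!(ler_nat R) !natrD.
by move=> le1 le2; apply/andP; split; lra.
Qed.

(** A generator has length at most [1], hence closeness at least [p - 2], which
    is enough when [closeness (u i)^-1] vanishes.  Otherwise the inverse is a
    product of [r] generators with [closeness (u i)^-1 = p - 2 r]; as [r + 1 >= p],
    this is at most [2 - p]. *)
Lemma gauge_generator_le i : gauge (u i) <= p%:R^-1 - 2^-1.
Proof.
have p_neq0 : p%:R != 0 :> R by rewrite pnatr_eq0 -lt0n.
have -> : p%:R^-1 - 2^-1 = (2 - p%:R) / (2 * p%:R) :> R.
  by field; rewrite p_neq0.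
rewrite ler_wpM2r ?invr_ge0 ?mulr_ge0 //.
suff : (closeness (u i)^-1%g + p <= 2 + closeness (u i))%N.
  by rewrite -(ler_nat R) !natrD => le; lra.
have spelled_u : spelled (u i) 1 by exists [:: i]; rewrite big_seq1.
have := closeness_ge spelled_u.
case: (posnP (closeness (u i)^-1%g)) => [->|/closeness_gt0[r ur Er]]; first by lia.
have := spelledM ur spelled_u; rewrite mulVg => /spelled_relation[|]; first by lia.
by lia.
Qed.

End Value.
End Gauge.

(** * The lower bound in an arbitrary free product *)

(** The quasimorphism is the sum of the two gauges over the letters; at [w] each
    of the [n] pairs of letters contributes at most [1/p + 1/q - 1]. *)
Lemma scl_freeprod_ge (R : realType) (A B : groupType) (n p q : nat)
    (u : 'I_n -> A) (v : 'I_n -> B) :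
  (0 < p)%N -> (0 < q)%N ->
  (forall j, u j != 1%g) -> (forall j, v j != 1%g) ->
  (forall s : seq 'I_n, s <> [::] -> (\prod_(j <- s) u j = 1)%g -> (p <= size s)%N) ->
  (forall s : seq 'I_n, s <> [::] -> (\prod_(j <- s) v j = 1)%g -> (q <= size s)%N) ->
  let w := (\prod_(j < n) (fp_inl B (u j) * fp_inr A (v j)))%g in
  in_derived w -> n%:R / 2 * (1 - 1 / p%:R - 1 / q%:R) <= scl R w.
Proof.
move=> p_gt0 q_gt0 u1 v1 relu relv w dw.
pose f : A -> R := gauge u p R; pose g : B -> R := gauge v q R.
have f_odd : forall a, f a^-1%g = - f a by apply: gauge_odd.
have g_odd : forall b, g b^-1%g = - g b by apply: gauge_odd.
have half_gt0 : 0 < 2^-1 :> R by rewrite invr_gt0.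
have f_defect := gauge_defect relu R p_gt0; have g_defect := gauge_defect relv R q_gt0.
have w_ge : n%:R * (1 - p%:R^-1 - q%:R^-1) <= `|rolli f g w|.
  rewrite -normrN (le_trans _ (ler_norm _)) // rolli_prod1 //.
  rewrite -sumrN mulr_natl -[in leLHS](card_ord n) -sumr_const ler_sum // => j _.
  have := gauge_generator_le relu R p_gt0 j.
  have := gauge_generator_le relv R q_gt0 j.
  by rewrite -/f -/g => le1 le2; lra.
pose F (x : freeprod A B) : R := rolli f g x.
have F_odd : forall x, F x^-1%g = - F x by apply: rolli_odd.
have F_defect : forall x y, `|F (x * y)%g - F x - F y| <= 2^-1.
  by apply: rolli_defect; rewrite ?ltW.
have F_X k : F (w ^+ k)%g = F w *+ k by apply: rolli_prodX.
apply: le_trans (scl_ge_quasimorphism F_odd F_defect half_gt0 dw F_X).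
rewrite !div1r mulrAC; have -> : 4 * 2^-1 = 2 :> R by field.
by rewrite ler_wpM2r.
Qed.

(** * Words in the free product of two free abelian groups *)

Section Zinf.
Local Open Scope group_scope.

(** The group law of [Zinf] is the addition of [{freeg nat}]; the next lemmas
    state the additivity of coefficients in multiplicative notation. *)
Lemma coeff_ZinfM i : {morph (fun a : Zinf => coeff i (a : {freeg nat})) :
  a b / a * b >-> (a + b)%R}.
Proof. exact: coeffD. Qed.

Lemma coeff_Zinf1 i : coeff i ((1 : Zinf) : {freeg nat}) = 0%R.
Proof. exact: coeff0. Qed.

Lemma coeff_Zinf_prod (I : Type) (s : seq I) (a : I -> Zinf) i :
  coeff i ((\prod_(j <- s) a j : Zinf) : {freeg nat}) =
  (\sum_(j <- s) coeff i (a j : {freeg nat}))%R.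
Proof. exact: (big_morph _ (coeff_ZinfM i) (coeff_Zinf1 i)). Qed.

Lemma coeff_ZinfV i (a : Zinf) :
  coeff i ((a^-1 : Zinf) : {freeg nat}) = (- coeff i (a : {freeg nat}))%R.
Proof. exact: coeffN. Qed.

Lemma coeff_zexpg i (a : Zinf) k :
  coeff i (zexpg a k : {freeg nat}) = (k * coeff i (a : {freeg nat}))%R.
Proof.
have coeffX m : coeff i ((a ^+ m : Zinf) : {freeg nat}) = (coeff i (a : {freeg nat}) *+ m)%R.
  elim: m => [|m IHm]; first exact: coeff_Zinf1.
  by rewrite expgS coeff_ZinfM IHm mulrS.
by case: k => m /=; rewrite ?coeff_ZinfV coeffX ?NegzE ?mulNr -natz mulr_natl.
Qed.

Lemma Zinf_eq1 (a : Zinf) : (forall i, coeff i (a : {freeg nat}) = 0%R) -> a = 1.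
Proof.
by move=> a0; apply/eqP/freeg_eqP => i; rewrite a0 coeff_Zinf1.
Qed.

(** The [j]-th syllable of the word, as an element of one factor. *)
Definition column n (z : fsseq n) (j : 'I_n) : Zinf :=
  \prod_(i <- finsupp z) zexpg (<< i >>%R : Zinf) (z i 0%R j).

Lemma coeff_column n (z : fsseq n) j i :
  coeff i (column z j : {freeg nat}) = z i 0%R j.
Proof.
rewrite coeff_Zinf_prod.
have summandE k : coeff i (zexpg (<< k >>%R : Zinf) (z k 0%R j) : {freeg nat}) =
    (z k 0 j * (k == i)%:R)%R.
  by rewrite coeff_zexpg coeffU mul1r.
under eq_bigr do rewrite summandE.
have [zi|zi] := boolP (i \in finsupp z); last first.
  rewrite (fsfun_dflt zi) mxE big_seq big1 // => k zk.
  by case: eqP => [ki|]; rewrite ?mulr0 //; rewrite -ki zk in zi.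
rewrite (bigD1_seq i) ?fset_uniq //= eqxx mulr1 big1 ?addr0 // => k /negPf->.
by rewrite mulr0.
Qed.

Lemma column_neq1 n (z : fsseq n) j : M n z -> column z j != 1.
Proof.
move=> [_ /(_ j)[i zij]]; apply: contra zij => /eqP cz1.
by rewrite -coeff_column cz1 coeff_Zinf1.
Qed.

Lemma column_prod n (z : fsseq n) : M n z -> \prod_(j < n) column z j = 1.
Proof.
move=> [Uz _]; apply: Zinf_eq1 => i; rewrite coeff_Zinf_prod.
by under eq_bigr do rewrite coeff_column; apply: Uz.
Qed.

Lemma sum_count_mem (V : nmodType) (n : nat) (s : seq 'I_n) (F : 'I_n -> V) :
  (\sum_(j <- s) F j = \sum_(j < n) F j *+ count_mem j s)%R.
Proof.
elim: s => [|k s IHs]; first by rewrite big_nil big1.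
rewrite big_cons IHs [in RHS](bigD1 k) //= eqxx mulrS -addrA; congr (_ + _)%R.
rewrite (bigD1 k) //=; congr (_ + _)%R; apply: eq_bigr => j /negPf.
by rewrite eq_sym => ->.
Qed.

(** The relation is seen coordinatewise with [lambda j] the number of occurrences
    of [j] in [s]. *)
Lemma column_relation n (z : fsseq n) p :
  (forall lambda : 'I_n -> nat, (exists j, lambda j <> 0%N) ->
     (forall i : nat, \sum_(j < n) (lambda j)%:Z * z i 0 j = 0)%R ->
     (p <= \sum_(j < n) lambda j)%N) ->
  forall s : seq 'I_n, s <> [::] -> \prod_(j <- s) column z j = 1 ->
  (p <= size s)%N.
Proof.
move=> relz s s0 prod1.
have -> : size s = (\sum_(j < n) count_mem j s)%N.
  rewrite -sum1_size (sum_count_mem s (fun=> 1%N : nat)).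
  by apply: eq_bigr => j _; rewrite natn.
apply: relz.
  case: s s0 {prod1} => // j s _; exists j; rewrite /= eqxx; lia.
move=> i; rewrite -[RHS](coeff_Zinf1 i) -prod1 coeff_Zinf_prod (sum_count_mem s).
by apply: eq_bigr => j _; rewrite coeff_column -mulr_natl natz.
Qed.

Lemma gmulf_zexpg (G H : groupType) (f : UMagmaMorphism.type G H) (a : G) k :
  f (zexpg a k) = zexpg (f a) k.
Proof. by case: k => m; [apply: gmulfXn|apply: gmulfXVn]. Qed.

Lemma phi_columns n (x y : fsseq n) : phi x y =
  \prod_(j < n) (fp_inl Zinf (column x j) * fp_inr Zinf (column y j)).
Proof.
rewrite /phi; apply: eq_bigr => j _; rewrite /column !gmulf_prod.
by congr (_ * _); apply: eq_bigr => i _; rewrite gmulf_zexpg.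
Qed.

Lemma phi_derived n (x y : fsseq n) : M n x -> M n y -> in_derived (phi x y).
Proof.
move=> hx hy; rewrite phi_columns; apply: in_derived_prod.
  by rewrite -gmulf_prod column_prod // gmulf1.
by rewrite -gmulf_prod column_prod // gmulf1.
Qed.

End Zinf.

Theorem mainTheorem2 (R : realType) (n : nat) (x y : fsseq n)
    (hx : M n x) (hy : M n y)
    (w : freeprod Zinf Zinf) (hw : w = phi x y)
    (p q : nat) (hp : (0 < p)%N) (hq : (0 < q)%N)
    (h1 : forall lambda : 'I_n -> nat, (exists j, lambda j <> 0%N) ->
       (forall i : nat, \sum_(j < n) (lambda j)%:Z * x i 0 j = 0) ->
       (p <= \sum_(j < n) lambda j)%N)
    (h2 : forall mu : 'I_n -> nat, (exists j, mu j <> 0%N) ->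
       (forall i : nat, \sum_(j < n) (mu j)%:Z * y i 0 j = 0) ->
       (q <= \sum_(j < n) mu j)%N) :
  n%:R / 2 * (1 - 1 / p%:R - 1 / q%:R) <= scl R w.
Proof.
have dw := phi_derived hx hy; rewrite phi_columns in dw.
rewrite hw phi_columns; apply: scl_freeprod_ge => //.
- by move=> j; apply: column_neq1.
- by move=> j; apply: column_neq1.
- exact: column_relation.
- exact: column_relation.
Qed.
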